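(* Let $(X,T)$ be a dynamical system and let $\mu\in M(X)$. Then $(T,\mu)$ satisfies LDT-II' if and only if $\mu$ is ergodic.
   Context: A dynamical system is a pair $(X,T)$ where $X$ is a compact metric space and $T:X\to X$ is continuous. $M(X)$ is the set of Borel probability measures on $X$ (not assumed $T$-invariant) and $M(X,T)\subset M(X)$ the set of $T$-invariant ones. An observable is a continuous complex-valued function $\varphi\in C(X)$. $(T,\mu)$ satisfies the large deviations theorem of type II' (LDT-II') if, for every observable $\varphi$ and any $\varepsilon>0$, $$\lim_{n\to+\infty}\mu\left(\left\{x\in X:\left|\frac{1}{n}\sum_{i=0}^{n-1}\varphi\circ T^{i}(x)-\int_X\varphi\,\mathrm{d}\mu\right|>\varepsilon\right\}\right)=0.$$ A measure $\mu\in M(X)$ is ergodic if $\mu\in M(X,T)$ and every Borel set $B$ with $T^{-1}(B)=B$ satisfies $\mu(B)\in\{0,1\}$. *)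

(* Defs.v *)
From HB Require Import structures.
From mathcomp Require Import all_boot all_order all_algebra.
From mathcomp Require Import all_classical all_reals all_analysis.
From mathcomp Require Import complex.

Set Implicit Arguments.
Unset Strict Implicit.
Unset Printing Implicit Defensive.

Import Order.TTheory GRing.Theory Num.Theory.
Import numFieldNormedType.Exports.

Local Open Scope classical_set_scope.
Local Open Scope ring_scope.
Local Open Scope complex_scope.

(* measurableType requires a point, which metricType does not provide.  This
   is harmless: a space carrying a probability measure is nonempty. *)
#[short(type="pmetricType")]
HB.structure Definition PointedMetric (K : numDomainType) :=
  {M of Metric K M & Pointed M}.

Notation borel_space X := (g_sigma_algebraType (@open X)).

Section LargeDeviations.
Context {R : realType} {X : pmetricType R}.
Implicit Types (T : X -> X) (mu : probability (borel_space X) R).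

Definition complex_integral mu (phi : X -> R[i]) : R[i] :=
  (\int[mu]_x complex.Re (phi x)) +i* (\int[mu]_x complex.Im (phi x)).

Definition birkhoff_average T (phi : X -> R[i]) (n : nat) (x : X) : R[i] :=
  n%:R^-1 * \sum_(i < n) phi (iter i T x).

(* The type R[i]^o carries the topology induced by the complex modulus.  The
   modulus itself takes its values in R[i], hence the coercion of eps. *)
Definition LDT_II' T mu : Prop :=
  forall phi : X -> R[i]^o, continuous phi -> forall eps : R, 0 < eps ->
    (fun n => mu [set x : X | eps%:C <
       `|birkhoff_average T phi n x - complex_integral mu phi|])
      @ \oo --> 0%E.

Definition invariant_measure T mu : Prop :=
  forall B : set (borel_space X), measurable B -> mu (T @^-1` B) = mu B.

Definition ergodic_measure T mu : Prop :=
  invariant_measure T mu /\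
  forall B : set (borel_space X), measurable B -> T @^-1` B = B ->
    mu B = 0%E \/ mu B = 1%E.

End LargeDeviations.

(* Main.v *)
(* Ergodicity implies the LDT by the maximal ergodic inequality.  For bounded f
   with negative integral, the set where the Birkhoff sums S_n f are unbounded
   above is T-invariant and cannot have measure 1, hence has measure 0, so that
   P (exists n, S_n f > k) -> 0 as k -> oo.  Apply this to f - (E f + eps / 2)
   and to its analogue for -f; f is real, complex observables being split into
   real and imaginary parts.

   Conversely, for bounded averages convergence in probability gives
   convergence of integrals over any Borel set.  The averages of f o T and of f
   are O(1/n)-close, so E (f o T) = E f for continuous f, hence T preserves mu.
   If B is invariant, the integral over B of S_n f / n is constantly that of f,
   hence equals mu B * E f.  Approximating open sets by continuous functions,
   mu (U n B) = mu B * mu U for all Borel U, and U = B gives mu B = (mu B)^2. *)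
From HB Require Import structures.
Require Import Defs.
From mathcomp Require Import all_boot all_order all_algebra.
From mathcomp Require Import all_classical all_reals all_analysis.
From mathcomp Require Import measurable_realfun.
From mathcomp Require Import complex ring lra.
Set Implicit Arguments.
Unset Strict Implicit.
Unset Printing Implicit Defensive.
Import Order.TTheory GRing.Theory Num.Theory.
Import numFieldNormedType.Exports.
Local Open Scope classical_set_scope.
Local Open Scope ring_scope.

(** * Birkhoff sums and their running maxima *)

Section BirkhoffSum.
Context {R : realType} {X : Type}.
Implicit Types (T : X -> X) (f : X -> R) (C c : R).

Definition birkhoff_sum T f (n : nat) (x : X) : R :=
  \sum_(i < n) f (iter i T x).

Lemma birkhoff_sum0 T f x : birkhoff_sum T f 0 x = 0.
Proof. by rewrite /birkhoff_sum big_ord0. Qed.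

Lemma birkhoff_sumS T f n x :
  birkhoff_sum T f n.+1 x = f x + birkhoff_sum T f n (T x).
Proof.
rewrite /birkhoff_sum big_ord_recl /=; congr (_ + _).
by apply: eq_bigr => i _; rewrite -iterSr.
Qed.

Lemma birkhoff_sum_comp T f n x :
  birkhoff_sum T (f \o T) n x = birkhoff_sum T f n (T x).
Proof. by apply: eq_bigr => i _; rewrite -iterSr. Qed.

Lemma birkhoff_sumB_cst T f c n x :
  birkhoff_sum T (fun y => f y - c) n x = birkhoff_sum T f n x - n%:R * c.
Proof.
by rewrite /birkhoff_sum sumrB sumr_const card_ord mulr_natl.
Qed.

Lemma birkhoff_sumN T f n x :
  birkhoff_sum T (fun y => - f y) n x = - birkhoff_sum T f n x.
Proof. by rewrite /birkhoff_sum sumrN. Qed.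

Lemma birkhoff_sum_bound T f C n x : (forall y, `|f y| <= C) ->
  `|birkhoff_sum T f n x| <= n%:R * C.
Proof.
move=> fC; apply: le_trans (ler_norm_sum _ _ _) _.
apply: le_trans (ler_sum _ (fun i _ => fC _)) _.
by rewrite sumr_const card_ord mulr_natl.
Qed.

(* The maximum of the Birkhoff sums of lengths [0, ..., n]. *)
Fixpoint birkhoff_max T f (n : nat) (x : X) : R :=
  if n is m.+1 then Num.max 0 (f x + birkhoff_max T f m (T x)) else 0.

Lemma birkhoff_max_ge0 T f n x : 0 <= birkhoff_max T f n x.
Proof. by case: n => [//|n] /=; rewrite le_max lexx. Qed.

Lemma birkhoff_max_le T f n x : birkhoff_max T f n x <= birkhoff_max T f n.+1 x.
Proof.
elim: n x => [|n IH] x; first exact: birkhoff_max_ge0.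
by rewrite /= ge_max !le_max lexx /= lerD2l IH orbT.
Qed.

Lemma birkhoff_sum_le_max T f n x : birkhoff_sum T f n x <= birkhoff_max T f n x.
Proof.
elim: n x => [|n IH] x; first by rewrite birkhoff_sum0.
by rewrite birkhoff_sumS /= le_max lerD2l IH orbT.
Qed.

Lemma birkhoff_max_bound T f C n x : (forall y, `|f y| <= C) ->
  `|birkhoff_max T f n x| <= n%:R * C.
Proof.
move=> fC; elim: n x => [|n IH] x; first by rewrite /= normr0 mul0r.
have C0 : 0 <= C by apply: le_trans (fC x).
rewrite ger0_norm ?birkhoff_max_ge0 //= ge_max mulr_ge0 //=.
by rewrite -natr1 mulrDl mul1r addrC lerD //; exact: le_trans (ler_norm _) _.
Qed.

End BirkhoffSum.

(** * Integrals of bounded functions on a probability space *)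

Section BoundedIntegral.
Context {d : measure_display} {X : measurableType d} {R : realType}.
Implicit Types (P : probability X R) (f g : X -> R) (B D : set X) (C e : R).

Lemma measurable_gt f e : measurable_fun setT f ->
  measurable [set x | e < f x].
Proof.
move=> mf; have := mf measurableT `]e, +oo[%classic (measurable_itv _).
rewrite setTI; congr measurable; apply/seteqP.
by split=> x /=; rewrite in_itv /= andbT.
Qed.

Lemma measurable_le f e : measurable_fun setT f ->
  measurable [set x | f x <= e].
Proof.
move=> mf; rewrite (_ : [set x | f x <= e] = ~` [set x | e < f x]).
  exact/measurableC/measurable_gt.
by apply/seteqP; split=> x /=; rewrite leNgt => /negP.
Qed.

Lemma bounded_integrable P f C B : measurable B -> measurable_fun setT f ->
  (forall x, `|f x| <= C) -> P.-integrable B (EFin \o f).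
Proof.
move=> mB mf fC; apply: measurable_bounded_integrable => //.
- exact: le_lt_trans (probability_le1 P mB) (ltry _).
- exact: measurable_funTS.
- exists C; split; first exact: num_real.
  by move=> M CM x _ /=; apply: le_trans (fC x) (ltW CM).
Qed.

(** The function [e + C * \1_D] dominates [|f|] everywhere: [C] takes over on the exceptional set
    [D], and [e] suffices off it. *)
Lemma Rintegral_le_indic P f C e B D : measurable B -> measurable D ->
  measurable_fun setT f -> 0 <= e -> (forall x, `|f x| <= C) ->
  (forall x, ~ D x -> `|f x| <= e) ->
  `|\int[P]_(x in B) f x| <= e + C * fine (P D).
Proof.
move=> mB mD mf e0 fC fe.
have C0 : 0 <= C by apply: le_trans (fC point).
have mi : measurable_fun setT (fun x => e + C * \1_D x : R).
  by apply: measurable_funD => //; apply: measurable_funM.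
have ind01 x : 0 <= (\1_D x : R) <= 1 by rewrite indicE ler0n lern1 leq_b1.
have hb x : `|e + C * \1_D x| <= e + C.
  have /andP[h0 h1] := ind01 x.
  by rewrite ger0_norm ?addr_ge0 ?mulr_ge0 // lerD2l ler_piMr.
apply: (le_trans (le_normr_Rintegral mB (bounded_integrable P mB mf fC))).
(* Extending [|f|] by zero outside [B] keeps it below the dominating function, which is
   nonnegative. *)
apply: (@le_trans _ _ (\int[P]_(x in setT) (e + C * \1_D x))).
  rewrite Rintegral_mkcond; apply: le_Rintegral => //.
  - apply: (@bounded_integrable _ _ C) => //.
      rewrite -measurable_restrictT //.
      exact/measurable_funTS/measurableT_comp.
    move=> x; rewrite patchE; case: ifP => _; rewrite ?normr0 //.
    by rewrite normr_id.
  - exact: bounded_integrable hb.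
  - move=> x _; rewrite patchE; have /andP[h0 h1] := ind01 x.
    case: ifP => _; last by rewrite addr_ge0 ?mulr_ge0.
    rewrite indicE; case: (boolP (x \in D)) => [|/negP]; rewrite inE => Dx.
      by rewrite mulr1 (le_trans (fC x)) // lerDr.
    by rewrite mulr0 addr0 fe.
have iD : P.-integrable setT (EFin \o \1_D).
  by apply: (@bounded_integrable _ _ 1) => // x; have /andP[h0 h1] := ind01 x;
    rewrite ger0_norm.
rewrite RintegralD //; last 2 first.
- by apply: (@bounded_integrable _ _ `|e|).
- apply: (@bounded_integrable _ _ C) => //; first exact: measurable_funM.
  move=> x; have /andP[h0 h1] := ind01 x.
  by rewrite ger0_norm ?mulr_ge0 // ler_piMr.
rewrite RintegralZl // Rintegral_cst //= (probability_setT P) mulr1.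
by rewrite /Rintegral integral_indic // setIT.
Qed.

(** Deviations up to [e / 2] contribute at most [e / 2]. Larger ones contribute at most [C + |c|]
    times the probability that they occur, which vanishes in the limit. *)
Lemma bounded_cvg_in_probability P (Y : nat -> X -> R) C c B : measurable B ->
  (forall n, measurable_fun setT (Y n)) -> (forall n x, `|Y n x| <= C) ->
  (forall e, 0 < e -> P [set x | e < `|Y n x - c|] @[n --> \oo] --> 0%E) ->
  (\int[P]_(x in B) Y n x) @[n --> \oo] --> c * fine (P B).
Proof.
move=> mB mY YC Yc.
have C0 : 0 <= C by apply: le_trans (YC 0%N point).
have mYc n : measurable_fun setT (fun x => Y n x - c) by exact: measurable_funB.
have YcC n x : `|Y n x - c| <= C + `|c|.
  by rewrite (le_trans (ler_normB _ _)) // lerD2r.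
(* The added 1 keeps [K] positive when [C] and [c] are 0, so that [e / 2 / K] is a valid
   tolerance. *)
pose K := C + `|c| + 1.
have K0 : 0 < K by rewrite /K ltr_wpDl ?addr_ge0.
apply/cvgrPdist_le => e e0.
have e20 : 0 < e / 2 by rewrite divr_gt0.
have /fine_cvgP[_ /cvgrPdist_le /(_ (e / 2 / K) (divr_gt0 e20 K0))] := Yc _ e20.
apply: filterS => n /=; rewrite sub0r normrN => Pn.
have mD : measurable [set x | e / 2 < `|Y n x - c|].
  by apply: measurable_gt; exact: measurableT_comp.
have := @Rintegral_le_indic P (fun x => Y n x - c) (C + `|c|) (e / 2) B _
   mB mD (mYc n) (ltW e20) (YcC n).
have -> : \int[P]_(x in B) (Y n x - c) = \int[P]_(x in B) Y n x - c * fine (P B).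
  rewrite RintegralB ?Rintegral_cst //; first exact: bounded_integrable (YC n).
  exact: (@bounded_integrable _ _ `|c|).
move=> H; rewrite distrC; apply: (le_trans (H _)).
  by move=> x /= /negP; rewrite -leNgt.
rewrite [leRHS](splitr e) lerD2l.
apply: (@le_trans _ _ (K * fine (P [set x | e / 2 < `|Y n x - c|]))).
  by rewrite ler_wpM2r ?fine_ge0 // /K lerDl.
by rewrite mulrC -ler_pdivlMr // (le_trans (ler_norm _)).
Qed.

End BoundedIntegral.

(** * Measure-preserving maps, the maximal inequality and ergodic averages *)

Section MeasurePreserving.
Context {d : measure_display} {X : measurableType d} {R : realType}.
Variables (P : probability X R) (T : X -> X).
Hypothesis mT : measurable_fun setT T.
Implicit Types (f : X -> R) (B : set X) (C c e : R).

Lemma measurable_birkhoff_sum f n :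
  measurable_fun setT f -> measurable_fun setT (birkhoff_sum T f n).
Proof.
move=> mf; elim: n => [|n IH].
  by rewrite (_ : birkhoff_sum T f 0 = cst 0) //; apply/funext => x;
    exact: birkhoff_sum0.
rewrite (_ : birkhoff_sum T f n.+1 = f \+ (birkhoff_sum T f n \o T)).
  by apply: measurable_funD => //; exact: measurableT_comp.
by apply/funext => x; exact: birkhoff_sumS.
Qed.

Lemma measurable_birkhoff_max f n :
  measurable_fun setT f -> measurable_fun setT (birkhoff_max T f n).
Proof.
move=> mf; elim: n => [|n IH] //=.
apply: measurable_maxr => //.
by apply: measurable_funD => //; exact: measurableT_comp.
Qed.

Hypothesis invT : forall B, measurable B -> P (T @^-1` B) = P B.

(** Change of variables along [T], whose pushforward of [P] is [P] itself. *)
Lemma Rintegral_preimage f C B : measurable B -> measurable_fun setT f ->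
  (forall x, `|f x| <= C) ->
  \int[P]_(x in T @^-1` B) f (T x) = \int[P]_(x in B) f x.
Proof.
move=> mB mf fC; rewrite /Rintegral; congr fine.
have mTB : measurable (T @^-1` B) by rewrite -[_ @^-1` _]setTI; exact: mT.
transitivity (\int[pushforward P T]_(x in B) (f x)%:E)%E.
  rewrite integral_pushforward //.
  - exact/measurable_EFinP.
  - apply: (@bounded_integrable _ _ _ P (f \o T) C) => //.
      exact: measurableT_comp.
    by move=> x; exact: fC.
by apply: eq_measure_integral => A mA _; exact: invT.
Qed.

Lemma Rintegral_comp f C : measurable_fun setT f -> (forall x, `|f x| <= C) ->
  \int[P]_x f (T x) = \int[P]_x f x.
Proof. by move=> mf fC; rewrite -(Rintegral_preimage measurableT mf fC). Qed.

Lemma Rintegral_birkhoff_sum f C B n : measurable B -> T @^-1` B = B ->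
  measurable_fun setT f -> (forall x, `|f x| <= C) ->
  \int[P]_(x in B) birkhoff_sum T f n x = n%:R * \int[P]_(x in B) f x.
Proof.
move=> mB TB mf fC; elim: n => [|n IH].
  under eq_Rintegral do rewrite birkhoff_sum0.
  by rewrite Rintegral_cst // !mul0r.
under eq_Rintegral do rewrite birkhoff_sumS.
have mS := measurable_birkhoff_sum n mf.
have SC x : `|birkhoff_sum T f n x| <= n%:R * C by exact: birkhoff_sum_bound.
rewrite RintegralD //; last 2 first.
- exact: bounded_integrable fC.
- apply: (@bounded_integrable _ _ _ P (birkhoff_sum T f n \o T) (n%:R * C)) => //.
    exact: measurableT_comp.
  by move=> x; exact: SC.
have := Rintegral_preimage mB mS SC; rewrite TB => ->.
by rewrite IH -natr1; ring.
Qed.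

(* With [M_n] the Birkhoff maxima, pointwise
   [M_(n+1) - M_n \o T <= f + C 1_{M_(n+1) <= 0}], and the left-hand side has nonnegative integral. *)
Lemma maximal_ergodic f C n : measurable_fun setT f ->
  (forall x, `|f x| <= C) ->
  - (C * fine (P [set x | birkhoff_max T f n.+1 x <= 0])) <= \int[P]_x f x.
Proof.
move=> mf fC; set D := [set x | _].
have C0 : 0 <= C by apply: le_trans (fC point).
have mM k := measurable_birkhoff_max k mf.
have MC k x : `|birkhoff_max T f k x| <= k%:R * C by exact: birkhoff_max_bound.
have mD : measurable D by exact: measurable_le.
have ind1 x : `|\1_D x| <= 1 :> R.
  by rewrite indicE ger0_norm ?ler0n // lern1 leq_b1.
have iM k : P.-integrable setT (EFin \o birkhoff_max T f k).
  exact: bounded_integrable (MC k).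
have iMT : P.-integrable setT (EFin \o (birkhoff_max T f n \o T)).
  apply: (@bounded_integrable _ _ _ _ _ (n%:R * C)) => //.
    exact: measurableT_comp.
  by move=> x; exact: MC.
have iD : P.-integrable setT (EFin \o \1_D).
  exact: (@bounded_integrable _ _ _ _ _ 1).
have iCD : P.-integrable setT (EFin \o (fun x => C * \1_D x)).
  apply: (@bounded_integrable _ _ _ _ _ C) => //; first exact: measurable_funM.
  by move=> x; rewrite normrM ger0_norm // ler_piMr.
have intf : P.-integrable setT (EFin \o f) by exact: bounded_integrable fC.
have le1 : \int[P]_x birkhoff_max T f n x <= \int[P]_x birkhoff_max T f n.+1 x.
  by apply: le_Rintegral => // x _; exact: birkhoff_max_le.
have ID : \int[P]_x (C * \1_D x) = C * fine (P D).
  by rewrite RintegralZl // /Rintegral integral_indic // setIT.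
have : \int[P]_x (birkhoff_max T f n.+1 x - birkhoff_max T f n (T x)) <=
       \int[P]_x (f x + C * \1_D x).
  apply: le_Rintegral => //.
  - apply: (@bounded_integrable _ _ _ _ _ (n.+1%:R * C + n%:R * C)) => //.
      by apply: measurable_funB => //; exact: measurableT_comp.
    by move=> x; rewrite (le_trans (ler_normB _ _)) // lerD.
  - apply: (@bounded_integrable _ _ _ _ _ (C + C)) => //.
      by apply: measurable_funD => //; exact: measurable_funM.
    move=> x; rewrite (le_trans (ler_normD _ _)) // lerD //.
    by rewrite normrM (ger0_norm C0) ler_piMr.
  move=> x _; rewrite indicE; case: (boolP (x \in D)) => /=.
    rewrite inE /D /= => M0; rewrite mulr1.
    have := birkhoff_max_ge0 T f n (T x).
    by have := ler_norm (- f x); rewrite normrN; have := fC x; lra.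
  move=> /negP; rewrite inE /D /= => /negP; rewrite -ltNge.
  (* Where [M_(n+1)] is positive the maximum is its second argument, so the difference is exactly
     [f x]. *)
  case: (leP (f x + birkhoff_max T f n (T x)) 0); first by rewrite ltxx.
  by move=> _ _; rewrite mulr0; lra.
rewrite RintegralB // RintegralD // ID.
by have := Rintegral_comp (mM n) (MC n) => /= ->; lra.
Qed.

Hypothesis ergT : forall B, measurable B -> T @^-1` B = B ->
  P B = 0%E \/ P B = 1%E.

(** These sets decrease in [k]; their intersection is the set where the Birkhoff sums are unbounded
    above. *)
Let exceed f (k : nat) := [set x | exists n, k%:R < birkhoff_sum T f n x].

Let measurable_exceed f k : measurable_fun setT f -> measurable (exceed f k).
Proof.
move=> mf; rewrite (_ : exceed f k =
    \bigcup_n [set x | k%:R < birkhoff_sum T f n x]).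
  by apply: bigcup_measurable => n _; apply: measurable_gt;
    exact: measurable_birkhoff_sum.
by apply/seteqP; split=> x /= => [[n h]|[n _ h]]; exists n.
Qed.

(** Adding or dropping the first orbit point changes a sum by at most [K], so level [k + K] at one
    point yields level [k] at the other. *)
Let exceed_bigcap_invariant f C : (forall x, `|f x| <= C) ->
  T @^-1` (\bigcap_k exceed f k) = \bigcap_k exceed f k.
Proof.
move=> fC; have [K CK] : exists K : nat, C <= K%:R.
  by exists (Num.trunc C).+1; apply/ltW; exact: truncnS_gt.
have fK x : `|f x| <= K%:R by exact: le_trans CK.
apply/seteqP; split => x /= Ax k _.
- have [n] := Ax (k + K)%N I; rewrite natrD => h; exists n.+1.
  rewrite birkhoff_sumS; have := ler_norm (- f x); rewrite normrN.
  by have := fK x; lra.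
(* The empty sum is 0 and exceeds no level, so there is a first term to drop. *)
- have [[|n]] := Ax (k + K)%N I; rewrite natrD.
    by rewrite birkhoff_sum0 ltNge addr_ge0.
  rewrite birkhoff_sumS => h; exists n.
  by have := ler_norm (f x); have := fK x; lra.
Qed.

Let exceed_homo f : {homo exceed f : n m / (n <= m)%N >-> (m <= n)%O}.
Proof.
move=> n m nm; apply/subsetPset => x [k h]; exists k.
by apply: le_lt_trans h; rewrite ler_nat.
Qed.

(** If the invariant intersection had measure 1, almost every point would have a positive Birkhoff
    sum. The error term of the maximal inequality would then tend to 0, forcing a nonnegative
    integral. *)
Lemma ergodic_exceed f C : measurable_fun setT f ->
  (forall x, `|f x| <= C) -> \int[P]_x f x < 0 ->
  P (exceed f k) @[k --> \oo] --> 0%E.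
Proof.
move=> mf fC f0; have mE k := measurable_exceed k mf.
have mA : measurable (\bigcap_k exceed f k) by exact: bigcap_measurable.
have cvgA : P (exceed f k) @[k --> \oo] --> P (\bigcap_k exceed f k).
  apply: nonincreasing_cvg_mu => //.
  exact: le_lt_trans (probability_le1 P _) (ltry _).
have [<- //|PA] := ergT mA (exceed_bigcap_invariant fC).
exfalso; pose F n := [set x | birkhoff_max T f n.+1 x <= 0].
have mF n : measurable (F n).
  by apply: measurable_le; exact: measurable_birkhoff_max.
have mIF : measurable (\bigcap_n F n) by exact: bigcap_measurable.
have PF0 : P (\bigcap_n F n) = 0%E.
  apply/eqP; rewrite eq_le measure_ge0 andbT.
  (* A point in every [F n] has no positive Birkhoff sum, so it already fails to lie in
     [exceed f 0]. *)
  have <- : P (~` (\bigcap_k exceed f k)) = 0%E.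
    by rewrite probability_setC // PA subee.
  apply: le_measure; rewrite ?inE //; first exact: measurableC.
  move=> x Fx /(_ 0%N I) [[|n]]; first by rewrite birkhoff_sum0 ltxx.
  rewrite ltNge => /negP; apply; apply: le_trans (Fx n I).
  exact: birkhoff_sum_le_max.
have : P (F n) @[n --> \oo] --> 0%E.
  rewrite -PF0; apply: nonincreasing_cvg_mu => //.
    exact: le_lt_trans (probability_le1 P _) (ltry _).
  apply/nonincreasing_seqP => n; apply/subsetPset => x.
  exact/le_trans/birkhoff_max_le.
move=> /fine_cvgP[_ cvgF].
have cvgC : - (C * fine (P (F n))) @[n --> \oo] --> - (C * 0).
  by apply: cvgN; apply: cvgM => //; exact: cvg_cst.
have : - (C * 0) <= \int[P]_x f x.
  apply: (cvgr_to_le cvgC); apply: nearW => n.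
  exact: maximal_ergodic.
by rewrite mulr0 oppr0 leNgt f0.
Qed.

(** The shifted function [g] has integral [- e / 2], while a deviation above [e] at time [n] makes
    its [n]-th Birkhoff sum exceed [n * e / 2], hence any fixed level once [n] is large. *)
Lemma ergodic_average_upper f C e : measurable_fun setT f ->
  (forall x, `|f x| <= C) -> 0 < e ->
  P [set x | e < n%:R^-1 * birkhoff_sum T f n x - \int[P]_x f x]
    @[n --> \oo] --> 0%E.
Proof.
move=> mf fC e0; set c := \int[P]_x f x.
pose g x := f x - (c + e / 2).
have mg : measurable_fun setT g by exact: measurable_funB.
have gC x : `|g x| <= C + `|c + e / 2|.
  by rewrite (le_trans (ler_normB _ _)) // lerD2r.
have g0 : \int[P]_x g x < 0.
  rewrite RintegralB //; first last.
  - exact: (@bounded_integrable _ _ _ _ _ `|c + e / 2|).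
  - exact: bounded_integrable fC.
  rewrite Rintegral_cst //= (probability_setT P) mulr1 -/c; lra.
have /fine_cvgP[_ /cvgrPdist_le cE] := ergodic_exceed mg gC g0.
apply/fine_cvgP; split.
  apply: nearW => n; apply: fin_num_measure.
  apply: measurable_gt; apply: measurable_funB => //.
  by apply: measurable_funM => //; exact: measurable_birkhoff_sum.
apply/cvgrPdist_le => r r0.
have [K _ KE] := cE r r0.
(* For [n >= N] the lower bound [n * (e / 2)] passes the level [K]. *)
have [N hN] : exists N : nat, K%:R / (e / 2) < N%:R.
  by exists (Num.trunc (K%:R / (e / 2))).+1; exact: truncnS_gt.
near=> n.
have n0 : (0 < n)%N by near: n; exists 1%N.
have Nn : (N <= n)%N by near: n; exists N.
(* The single set [exceed g K], of measure at most [r], contains the deviation sets of all large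
   times. *)
apply: le_trans (KE K (leqnn _)) => /=.
rewrite !sub0r !normrN !ger0_norm ?fine_ge0 //.
have mL : measurable [set x | e < n%:R^-1 * birkhoff_sum T f n x - c].
  apply: measurable_gt; apply: measurable_funB => //.
  by apply: measurable_funM => //; exact: measurable_birkhoff_sum.
apply: fine_le; rewrite ?fin_num_measure //; first exact: measurable_exceed.
apply: le_measure; rewrite ?inE //; first exact: measurable_exceed.
move=> x /= h; exists n.
rewrite birkhoff_sumB_cst.
have n0' : 0 < n%:R :> R by rewrite ltr0n.
have h1 : n%:R * (e + c) < birkhoff_sum T f n x.
  by rewrite mulrC -ltr_pdivlMr // mulrC; move: h; lra.
have h2 : K%:R < n%:R * (e / 2).
  rewrite -ltr_pdivrMr ?divr_gt0 //; apply: lt_le_trans hN _.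
  by rewrite ler_nat.
nra.
Unshelve. all: by end_near. Qed.

Lemma ergodic_average f C e : measurable_fun setT f ->
  (forall x, `|f x| <= C) -> 0 < e ->
  P [set x | e < `|n%:R^-1 * birkhoff_sum T f n x - \int[P]_x f x| ]
    @[n --> \oo] --> 0%E.
Proof.
move=> mf fC e0.
have mNf : measurable_fun setT (fun x => - f x) by exact: measurable_funN.
have NfC x : `|- f x| <= C by rewrite normrN.
have := cvgeD _ (ergodic_average_upper mf fC e0)
  (ergodic_average_upper mNf NfC e0).
rewrite adde0 => /(_ _ isT) cv.
apply: (squeeze_cvge _ (cvg_cst _) cv).
apply: nearW => n; rewrite measure_ge0 /=.
have mS g : measurable_fun setT g ->
    measurable_fun setT (fun x => n%:R^-1 * birkhoff_sum T g n x - \int[P]_x g x).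
  move=> mg; apply: measurable_funB => //.
  by apply: measurable_funM => //; exact: measurable_birkhoff_sum.
apply: le_trans (measureU2 _ _ _); [|exact/measurable_gt/mS..].
have IN : \int[P]_x (- f x) = - \int[P]_x f x.
  have := @RintegralZl _ _ _ P setT f (-1) measurableT
    (bounded_integrable P measurableT mf fC).
  by under eq_Rintegral do rewrite mulN1r; rewrite mulN1r.
apply: le_measure; rewrite ?inE.
- by apply: measurable_gt; apply: measurableT_comp => //; exact: mS.
- by apply: measurableU; apply: measurable_gt; exact: mS.
move=> x /=; rewrite ltr_normr => /orP[h|h]; [by left|right].
by rewrite birkhoff_sumN IN mulrN -opprD.
Qed.

End MeasurePreserving.

(** * Consequences of the convergence of averages in probability *)

Section AverageLimits.
Context {d : measure_display} {X : measurableType d} {R : realType}.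
Variables (P : probability X R) (T : X -> X).
Hypothesis mT : measurable_fun setT T.
Implicit Types (f : X -> R) (A B : set X) (C c e : R).

Let average f n x := n%:R^-1 * birkhoff_sum T f n x.

Let measurable_average f n : measurable_fun setT f ->
  measurable_fun setT (average f n).
Proof.
by move=> mf; apply: measurable_funM => //; exact: measurable_birkhoff_sum.
Qed.

Let average_bound f C n x : (forall y, `|f y| <= C) -> `|average f n x| <= C.
Proof.
move=> fC; rewrite normrM normfV normr_nat.
(* The average of length 0 is 0, because [0^-1 = 0]. *)
case: n => [|n]; first by rewrite invr0 mul0r (le_trans _ (fC x)).
by rewrite ler_pdivrMl ?ltr0n //; exact: birkhoff_sum_bound.
Qed.

(** The weak law of large numbers for one function. *)
Let LLN f := forall e, 0 < e ->
  P [set x | e < `|average f n x - \int[P]_y f y|] @[n --> \oo] --> 0%E.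

Let LLN_integral f C B : measurable B -> measurable_fun setT f ->
  (forall x, `|f x| <= C) -> LLN f ->
  (\int[P]_(x in B) average f n x) @[n --> \oo] -->
    \int[P]_x f x * fine (P B).
Proof.
move=> mB mf fC Lf; apply: (bounded_cvg_in_probability mB) Lf.
  by move=> n; exact: measurable_average.
by move=> n x; exact: average_bound fC.
Qed.

(** The averages of [f \o T] and [f] differ by a telescoped term of size [O(1/n)], so the limits of
    their integrals coincide. *)
Lemma LLN_Rintegral_comp f C : measurable_fun setT f ->
  (forall x, `|f x| <= C) -> LLN f -> LLN (f \o T) ->
  \int[P]_x f (T x) = \int[P]_x f x.
Proof.
move=> mf fC Lf LfT.
have mfT : measurable_fun setT (f \o T) by exact: measurableT_comp.
have fTC x : `|(f \o T) x| <= C by exact: fC.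
have C0 : 0 <= C by apply: le_trans (fC point).
have := LLN_integral measurableT mf fC Lf.
have := LLN_integral measurableT mfT fTC LfT.
rewrite (probability_setT P) /= !mulr1 => cvT cv.
apply/eqP; rewrite -subr_eq0; apply/eqP.
have cv0 : (\int[P]_x average (f \o T) n x - \int[P]_x average f n x)
    @[n --> \oo] --> (0 : R).
  apply/cvgrPdist_le => e e0.
  have [N hN] : exists N : nat, (C + C) / e < N%:R.
    by exists (Num.trunc ((C + C) / e)).+1; exact: truncnS_gt.
  near=> n.
  have n0 : 0 < n%:R :> R by rewrite ltr0n; near: n; exists 1%N.
  have Nn : (N <= n)%N by near: n; exists N.
  rewrite sub0r normrN -RintegralB //; last 2 first.
  - apply: (bounded_integrable _ _ (measurable_average n mfT)) => // x.
    exact: average_bound fTC.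
  - apply: (bounded_integrable _ _ (measurable_average n mf)) => // x.
    exact: average_bound fC.
  have avgB x : average (f \o T) n x - average f n x =
      n%:R^-1 * (f (iter n T x) - f x).
    rewrite /average birkhoff_sum_comp -mulrBr; congr (_ * _).
    (* The sum of length [n + 1] is split both at its first and at its last term. *)
    have := birkhoff_sumS T f n x; rewrite {1}/birkhoff_sum big_ord_recr /=.
    by rewrite -/(birkhoff_sum T f n x) => h; lra.
  have avgC x : `|average (f \o T) n x - average f n x| <= (C + C) / n%:R.
    rewrite avgB normrM normfV normr_nat mulrC ler_wpM2r ?invr_ge0 //.
    by rewrite (le_trans (ler_normB _ _)) // lerD.
  (* With an empty exceptional set the estimate is the uniform bound. *)
  apply: le_trans (Rintegral_le_indic P measurableT measurable0 _ _ avgC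
    (fun x _ => avgC x)) _.
  - by apply: measurable_funB; exact: measurable_average.
  - by rewrite divr_ge0 ?addr_ge0.
  rewrite measure0 /= mulr0 addr0 ler_pdivrMr // -ler_pdivrMl // mulrC.
  by rewrite (le_trans (ltW hN)) // ler_nat.
rewrite -(cvg_lim (@Rhausdorff R) (cvgB cvT cv)).
exact: (cvg_lim (@Rhausdorff R) cv0).
Unshelve. all: by end_near. Qed.

(** Invariance of [P] and [B] makes the integral of the average over [B] independent of [n > 0], so
    it equals the limit given by the weak law. *)
Lemma LLN_Rintegral_invariant f C B :
  (forall A, measurable A -> P (T @^-1` A) = P A) ->
  measurable B -> T @^-1` B = B -> measurable_fun setT f ->
  (forall x, `|f x| <= C) -> LLN f ->
  \int[P]_(x in B) f x = \int[P]_x f x * fine (P B).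
Proof.
move=> invT mB TB mf fC Lf.
have cv := LLN_integral mB mf fC Lf.
rewrite -(cvg_lim (@Rhausdorff R) cv); apply/esym/(cvg_lim (@Rhausdorff R)).
apply: cvg_near_cst; near=> n.
have n0 : n%:R != 0 :> R by rewrite pnatr_eq0 -lt0n; near: n; exists 1%N.
have mS := measurable_birkhoff_sum mT n mf.
rewrite RintegralZl //; last first.
  apply: (bounded_integrable _ _ mS) => // x; exact: birkhoff_sum_bound fC.
by rewrite (Rintegral_birkhoff_sum mT invT n mB TB mf fC) mulKf.
Unshelve. all: by end_near. Qed.

(** Dominated convergence with the constant 1; it carries identities from continuous functions to
    open sets. *)
Lemma cvg_Rintegral_indic (h : nat -> X -> R) A B :
  measurable A -> measurable B -> (forall k, measurable_fun setT (h k)) ->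
  (forall k x, `|h k x| <= 1) -> (forall x, h k x @[k --> \oo] --> (\1_A x : R)) ->
  (\int[P]_(x in B) h k x) @[k --> \oo] --> fine (P (A `&` B)).
Proof.
move=> mA mB mh h1 hA.
have [|||||_ _] := @dominated_convergence _ _ _ P B mB
    (fun k => EFin \o h k) (EFin \o \1_A) (cst 1%E).
- by move=> k; apply/measurable_funTS/measurable_EFinP.
- by apply/measurable_funTS/measurable_EFinP.
- by apply: aeW => x _ /=; apply: cvg_EFin; [exact: nearW|exact: hA].
- by apply: (@bounded_integrable _ _ _ P (cst 1) 1) => // x; rewrite normr1.
- apply: aeW => x k _ /=. by rewrite lee_fin.
rewrite integral_indic // => cv; apply: fine_cvg.
by rewrite fineK // fin_num_measure //; exact: measurableI.
Qed.

End AverageLimits.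

(** * Continuous functions and open sets in the Borel space *)

Section BorelSpace.
Context {R : realType} {X : pmetricType R}.
Implicit Types (f : X -> R) (T : X -> X) (U : set X).

Lemma open_measurable_borel U : open U -> measurable (U : set (borel_space X)).
Proof. exact: sub_sigma_algebra. Qed.

Lemma continuous_borel_measurable f : continuous f ->
  measurable_fun setT (f : borel_space X -> R).
Proof.
move=> /continuousP cf; apply: (measurability _ (RGenOpens.measurableE R)).
move=> _ [_ [a [b ->] <-]]; rewrite setTI.
by apply: (@open_measurable_borel (f @^-1` _)); apply: cf; exact: interval_open.
Qed.

Lemma continuous_borel_measurable_self T : continuous T ->
  measurable_fun setT (T : borel_space X -> borel_space X).
Proof.
move=> /continuousP cT.
apply: (@measurability _ _ (borel_space X) (borel_space X) setT T (@open X) erefl).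
move=> _ [U oU <-]; rewrite setTI.
by apply: (@open_measurable_borel (T @^-1` U)); exact: cT.
Qed.

Lemma compact_continuous_bounded f : compact [set: X] -> continuous f ->
  exists C, forall x, `|f x| <= C.
Proof.
move=> hX cf.
have : compact (f @` [set: X]).
  by apply: continuous_compact => //; exact: continuous_subspaceT.
move=> /compact_bounded [M [_ hM]]; exists (M + 1) => x.
by apply: (hM (M + 1)); [rewrite ltrDl|exists x].
Qed.

(** The witness is the distance to the complement of [U]. *)
Lemma open_cozero U : open U ->
  exists g : X -> R, [/\ continuous g, forall x, 0 <= g x &
    forall x, U x <-> 0 < g x].
Proof.
(* The distance to an empty complement would be infinite, so the whole space gets the constant 1;
   otherwise a point [a] outside [U] makes the distance finite. *)
move=> oU; have [UT|/existsNP[a Ua]] := pselect (forall x, U x).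
  by exists (cst 1); split => // x; exact: cvg_cst.
pose g x := @edist_inf R X (~` U) x.
have gfin x : g x \is a fin_num.
  rewrite ge0_fin_numE ?edist_inf_ge0 //.
  apply: (@le_lt_trans _ _ (edist (x, a))).
    by apply: ereal_inf_lbound; exists a.
  rewrite -ge0_fin_numE //; apply/edist_finP; exists (mdist x a + 1).
    by rewrite ltr_wpDl ?mdist_ge0.
  by rewrite ballEmdist /= ltrDl.
exists (fine \o g); split.
- move=> x; apply: fine_cvg; rewrite fineK //; exact: edist_inf_continuous.
- by move=> x; rewrite fine_ge0 // edist_inf_ge0.
move=> x; split => [Ux|]; last first.
  by apply: contraPP => Ux /=; rewrite /g edist_inf0 //= ltxx.
(* A ball of radius [e] inside [U] keeps the complement at distance at least [e]. *)
have /nbhs_ballP[e /= e0 xU] := open_nbhs_nbhs (conj oU Ux).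
rewrite -lte_fin fineK //; apply: (@lt_le_trans _ _ e%:E); first by rewrite lte_fin.
apply: le_ereal_inf_tmp => _ [b Ub <-]; rewrite leNgt; apply/negP.
by move=> /edist_lt_ball /xU.
Qed.

(** The truncations [min 1 (k * g)] vanish off [U] and reach 1 at [x] in [U] once [k >= 1 / g x]. *)
Lemma open_indic_approx U : open U ->
  exists h : nat -> X -> R, [/\ forall k, continuous (h k),
    forall k x, `|h k x| <= 1 & forall x, h k x @[k --> \oo] --> (\1_U x : R)].
Proof.
move=> /open_cozero[g [cg g0 Ug]]; exists (fun k x => Num.min 1 (k%:R * g x)).
split.
- move=> k x; apply: (@continuous_min _ _ (cst 1) (fun x => k%:R * g x)).
    exact: cvg_cst.
  by apply: cvgM; [exact: cvg_cst|exact: cg].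
- move=> k x; rewrite ger0_norm ?ge_min ?lexx //.
  by rewrite le_min ler01 mulr_ge0.
move=> x; rewrite indicE; case: (boolP (x \in U)) => [|/negP]; rewrite inE.
  move=> /Ug gx; apply: cvg_near_cst.
  have [N hN] : exists N : nat, (g x)^-1 < N%:R.
    by exists (Num.trunc (g x)^-1).+1; exact: truncnS_gt.
  exists N => // n /= Nn; apply: min_l.
  rewrite -ler_pdivrMr // div1r (le_trans (ltW hN)) // ler_nat //.
move=> Ux; have -> : g x = 0.
  by apply/eqP; rewrite eq_le g0 andbT leNgt; apply/negP => /Ug.
apply: cvg_near_cst; apply: nearW => n; rewrite mulr0; exact: min_r.
Qed.

End BorelSpace.

(** * Passage between real and complex observables *)

Section RealLDT.
Context {R : realType} {X : pmetricType R}.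
Variables (T : X -> X) (mu : probability (borel_space X) R).

Definition real_LDT := forall f : X -> R, continuous f -> forall e : R, 0 < e ->
  mu [set x : X | e < `|n%:R^-1 * birkhoff_sum T f n x - \int[mu]_x f x|]
    @[n --> \oo] --> 0%E.

Local Open Scope complex_scope.

Lemma continuous_real_complex (f : X -> R) : continuous f ->
  continuous ((fun x => (f x)%:C) : X -> R[i]^o).
Proof.
move=> cf x; apply/cvgrPdist_lt => -[e e'] /=.
(* In the order of [R[i]] a positive element has zero imaginary part, so the radius is real. *)
rewrite ltcE /= => /andP[/eqP -> e0].
have /cvgrPdist_lt /(_ e e0) := cf x; apply: filterS => y.
by rewrite -rmorphB normc_def /= expr0n addr0 sqrtr_sqr complexr0 ltcR.
Qed.

Lemma continuous_Re (phi : X -> R[i]^o) : continuous phi ->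
  continuous (fun x => complex.Re (phi x)).
Proof.
move=> cphi x; apply/cvgrPdist_lt => e e0.
have e0' : 0 < e%:C by rewrite ltcR.
have /cvgrPdist_lt /(_ _ e0') := cphi x; apply: filterS => y.
by rewrite -ltcR -raddfB; apply: le_lt_trans; exact: normc_ge_Re.
Qed.

Lemma normc_ge_Im (z : R[i]) : `|complex.Im z|%:C <= `|z|.
Proof. by rewrite normc_def lecR -sqrtr_sqr ler_wsqrtr // lerDr sqr_ge0. Qed.

(** If both parts were at most [e / 2] in absolute value, the squared modulus would be at most
    [e^2 / 2]. *)
Lemma normc_gt_ReIm (z : R[i]) (e : R) : 0 < e -> e%:C < `|z| ->
  e / 2 < `|complex.Re z| \/ e / 2 < `|complex.Im z|.
Proof.
move=> e0; rewrite normc_def ltcR => ez.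
have [|Re_le] := ltP (e / 2) `|complex.Re z|; first by left.
have [|Im_le] := ltP (e / 2) `|complex.Im z|; first by right.
move: ez; rewrite ltNge => /negP; case.
rewrite -[leRHS](ger0_norm (ltW e0)) -sqrtr_sqr ler_wsqrtr //.
rewrite -(real_normK (num_real (complex.Re z))).
rewrite -(real_normK (num_real (complex.Im z))).
have := normr_ge0 (complex.Re z); have := normr_ge0 (complex.Im z); nra.
Qed.

Lemma continuous_Im (phi : X -> R[i]^o) : continuous phi ->
  continuous (fun x => complex.Im (phi x)).
Proof.
move=> cphi x; apply/cvgrPdist_lt => e e0.
have e0' : 0 < e%:C by rewrite ltcR.
have /cvgrPdist_lt /(_ _ e0') := cphi x; apply: filterS => y.
by rewrite -ltcR -raddfB; apply: le_lt_trans; exact: normc_ge_Im.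
Qed.

(** For a real function viewed as complex the integral has zero imaginary part, so the deviation
    events are the same sets. *)
Lemma LDT_real : LDT_II' T mu -> real_LDT.
Proof.
move=> L f cf e e0.
suff -> : (fun n => mu [set x : X |
      e < `|n%:R^-1 * birkhoff_sum T f n x - \int[mu]_x f x|]) =
    (fun n => mu [set x : X | e%:C < `|birkhoff_average T (fun x => (f x)%:C) n x
      - complex_integral mu (fun x => (f x)%:C)|]).
  exact: (L _ (continuous_real_complex cf) e e0).
apply/funext => n; congr (mu _); apply/funext => x /=; congr is_true.
have -> : birkhoff_average T (fun x => (f x)%:C) n x =
    (n%:R^-1 * birkhoff_sum T f n x)%:C.
  by rewrite rmorphM fmorphV rmorph_nat rmorph_sum.
rewrite /complex_integral /= Rintegral_cst // mul0r complexr0 -rmorphB.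
by rewrite normc_def /= expr0n addr0 sqrtr_sqr ltcR.
Qed.

Hypothesis cT : continuous T.

Let measurable_deviation (f : X -> R) (c : R) n : continuous f ->
  measurable_fun setT ((fun x => n%:R^-1 * birkhoff_sum T f n x - c)
    : borel_space X -> R).
Proof.
move=> cf; apply: measurable_funB => //; apply: measurable_funM => //.
apply: measurable_birkhoff_sum; first exact: continuous_borel_measurable_self.
exact: continuous_borel_measurable.
Qed.

Lemma Re_birkhoff_average phi n x :
  complex.Re (birkhoff_average T phi n x) =
  n%:R^-1 * birkhoff_sum T (fun y => complex.Re (phi y)) n x :> R.
Proof.
rewrite /birkhoff_average -(rmorph_nat (real_complex R)) -fmorphV /=.
rewrite /birkhoff_sum -raddf_sum.
by case: (\sum_(i < n) _) => a b /=; rewrite mul0r subr0.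
Qed.

Lemma Im_birkhoff_average phi n x :
  complex.Im (birkhoff_average T phi n x) =
  n%:R^-1 * birkhoff_sum T (fun y => complex.Im (phi y)) n x :> R.
Proof.
rewrite /birkhoff_average -(rmorph_nat (real_complex R)) -fmorphV /=.
rewrite /birkhoff_sum -raddf_sum.
by case: (\sum_(i < n) _) => a b /=; rewrite mul0r addr0.
Qed.

(** Union bound: a complex deviation above [e] forces one above [e / 2] in the real or the imaginary
    part. *)
Lemma real_LDT_complex : real_LDT -> LDT_II' T mu.
Proof.
move=> L phi cphi e e0.
have e20 : 0 < e / 2 by rewrite divr_gt0.
have cRe := continuous_Re cphi; have cIm := continuous_Im cphi.
have := cvgeD _ (L _ cRe _ e20) (L _ cIm _ e20).
rewrite adde0 => /(_ _ isT) cv.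
apply: (squeeze_cvge _ (cvg_cst _) cv); apply: nearW => n.
rewrite measure_ge0 /=.
set c := complex_integral mu phi.
have mRe := measurable_deviation (complex.Re c) n cRe.
have mIm := measurable_deviation (complex.Im c) n cIm.
have devRe x : complex.Re (birkhoff_average T phi n x - c) = n%:R^-1 *
    birkhoff_sum T (fun y => complex.Re (phi y)) n x - complex.Re c.
  by rewrite raddfB /= Re_birkhoff_average.
have devIm x : complex.Im (birkhoff_average T phi n x - c) = n%:R^-1 *
    birkhoff_sum T (fun y => complex.Im (phi y)) n x - complex.Im c.
  by rewrite raddfB /= Im_birkhoff_average.
have mabs (g : borel_space X -> R) : measurable_fun setT g ->
    measurable [set x | e / 2 < `|g x|].
  by move=> mg; apply: measurable_gt; exact: measurableT_comp.
apply: le_trans (measureU2 _ (mabs _ mRe) (mabs _ mIm)).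
apply: le_measure; rewrite ?inE.
(* Measurability of the complex event is obtained by writing the modulus as a real square root. *)
- rewrite (_ : [set x | _] = [set x | e < Num.sqrt (
      (n%:R^-1 * birkhoff_sum T (fun y => complex.Re (phi y)) n x
        - complex.Re c) ^+ 2 +
      (n%:R^-1 * birkhoff_sum T (fun y => complex.Im (phi y)) n x
        - complex.Im c) ^+ 2)]).
    apply: (@measurable_gt _ (borel_space X)).
    apply: measurableT_comp.
      by apply: continuous_measurable_fun; exact: sqrt_continuous.
    by apply: measurable_funD; exact: measurable_funX.
  by apply/funext => x /=; rewrite normc_def ltcR devRe devIm.
- by apply: measurableU; exact: mabs.
by move=> x /= /(normc_gt_ReIm e0); rewrite devRe devIm.
Qed.

End RealLDT.

(** * Large deviations and ergodicity *)

Section Main.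
Context {R : realType} {X : pmetricType R}.
Variables (T : X -> X) (mu : probability (borel_space X) R).
Hypothesis cT : continuous T.

Let mT := continuous_borel_measurable_self cT.

Let measurable_preimage_T (U : set (borel_space X)) :
  measurable U -> measurable (T @^-1` U : set (borel_space X)).
Proof. by move=> mU; rewrite -[_ @^-1` _]setTI; exact: mT. Qed.

Lemma ergodic_real_LDT : compact [set: X] -> ergodic_measure T mu ->
  real_LDT T mu.
Proof.
move=> hX [inv erg] f cf e e0.
have [C fC] := compact_continuous_bounded hX cf.
exact: (ergodic_average mT inv erg (continuous_borel_measurable cf) fC e0).
Qed.

(** Open sets are stable under intersection and generate the Borel sets, so it suffices that the
    pushforward and [mu] agree on them. *)
Lemma real_LDT_invariant : real_LDT T mu -> invariant_measure T mu.
Proof.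
move=> L B mB.
(* Bundling [T] with its measurability gives the pushforward its measure structure. *)
pose phi : {mfun (borel_space X) >-> (borel_space X)} :=
  HB.pack (T : borel_space X -> borel_space X) (isMeasurableFun.Build _ _ _ _ _ mT).
apply: (@measure_unique _ _ (borel_space X) (@open X) (fun=> setT) erefl _ _ _
  (pushforward mu phi) mu) => //.
- exact: openI.
- by move=> _; exact: openT.
- by rewrite bigcup_const.
- move=> U oU; have mU := open_measurable_borel oU.
  have [h [ch h1 hU]] := open_indic_approx oU.
  have mh k := continuous_borel_measurable (ch k).
  have cvU := cvg_Rintegral_indic (P := mu) mU measurableT mh h1 hU.
  have cvTU := cvg_Rintegral_indic (P := mu) (measurable_preimage_T mU) measurableT
    (fun k => measurableT_comp (mh k) mT) (fun k x => h1 k (T x))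
    (fun x => hU (T x)).
  rewrite !setIT in cvU cvTU.
  have E k : \int[mu]_x (h k \o T) x = \int[mu]_x h k x.
    apply: (LLN_Rintegral_comp mT (mh k) (h1 k)); apply: L => //.
    by move=> x; apply: continuous_comp; [exact: cT|exact: ch].
  rewrite (_ : (fun k => _) = (fun k => \int[mu]_x h k x)) in cvTU; last first.
    by apply/funext => k; exact: E.
  rewrite /pushforward -[LHS]fineK ?fin_num_measure //;
    last exact: measurable_preimage_T.
  rewrite -[RHS]fineK ?fin_num_measure //; congr (_%:E).
  by rewrite -(cvg_lim (@Rhausdorff R) cvTU) (cvg_lim (@Rhausdorff R) cvU).
- by move=> _; exact: le_lt_trans (probability_le1 mu measurableT) (ltry _).
Qed.

Lemma real_LDT_ergodic : real_LDT T mu -> ergodic_measure T mu.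
Proof.
move=> L; have inv := real_LDT_invariant L; split=> // B mB TB.
pose r : {nonneg R} := NngNum (fine_ge0 (measure_ge0 mu B)).
(* The finite measures [U |-> mu (U n B)] and [mu B * mu] agree on open sets, hence on all Borel
   sets, in particular at [B]. *)
have main : mrestr mu mB B = mscale r mu B.
  apply: (@measure_unique _ _ (borel_space X) (@open X) (fun=> setT) erefl _ _ _
    (mrestr mu mB) (mscale r mu)) => //.
  - exact: openI.
  - by move=> _; exact: openT.
  - by rewrite bigcup_const.
  - move=> U oU; have mU := open_measurable_borel oU.
    have [h [ch h1 hU]] := open_indic_approx oU.
    have mh k := continuous_borel_measurable (ch k).
    have cvU := cvg_Rintegral_indic (P := mu) mU measurableT mh h1 hU.
    have cvB := cvg_Rintegral_indic (P := mu) mU mB mh h1 hU.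
    rewrite setIT in cvU.
    have E k : \int[mu]_(x in B) h k x = \int[mu]_x h k x * fine (mu B).
      by apply: (LLN_Rintegral_invariant mT inv mB TB (mh k) (h1 k)); exact: L.
    rewrite (_ : (fun k => _) = (fun k => \int[mu]_x h k x * fine (mu B))) in cvB;
      last by apply/funext => k; exact: E.
    rewrite /= /mrestr /mscale /= -[LHS]fineK; last first.
      by rewrite fin_num_measure //; exact: measurableI.
    rewrite -[X in (_ * X)%E]fineK ?fin_num_measure //.
    rewrite -EFinM; congr (_%:E); rewrite mulrC.
    rewrite -(cvg_lim (@Rhausdorff R) cvB); apply: cvg_lim => //.
    by apply: cvgM => //; exact: cvg_cst.
  - move=> _; rewrite /= /mrestr setTI.
    exact: le_lt_trans (probability_le1 mu mB) (ltry _).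
(* The value at [B] reads [mu B = mu B * mu B], factored as [mu B * (1 - mu B) = 0]. *)
move: main; rewrite /mrestr /mscale setIid /=.
rewrite -[mu B]fineK ?fin_num_measure // -EFinM => -[] /eqP.
rewrite -subr_eq0 -{1}[fine _]mulr1 -mulrBr mulf_eq0 subr_eq0.
by case/orP => [/eqP ->|/eqP <-]; [left|right].
Qed.

End Main.

Theorem theorem3p3 (R : realType) (X : pmetricType R) (T : X -> X)
    (hX : compact [set: X]) (hT : continuous T)
    (mu : probability (borel_space X) R) :
  LDT_II' T mu <-> ergodic_measure T mu.
Proof.
split=> [/LDT_real|/(ergodic_real_LDT hT hX)]; first exact: real_LDT_ergodic.
exact: real_LDT_complex.
Qed.
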